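(* Let $M\preceq L$ be symmetric matrices in $\mathbb{R}^{d\times d}$, let $n\ge3d$ and $\rho\in[0,1)$. Put $\widetilde L=L-M$, $\Pi=\Pi_{\ker(L-M)}$, and let $J_1,J_2,J_3\in\mathbb{R}^{d\times n}$ be $$J_1=\begin{pmatrix}I_d&0\end{pmatrix},\quad J_2=\begin{pmatrix}0_d&I_d&0\end{pmatrix},\quad J_3=\begin{pmatrix}0_d&0_d&I_d&0\end{pmatrix}.$$ Then the following are equivalent. (a) (Analysis conditions) There exist $A\in\mathbb{R}^{n\times n}$, $B\in\mathbb{R}^{n\times d}$, $C\in\mathbb{R}^{d\times n}$, a symmetric positive definite $P\in\mathbb{R}^{(n+d)\times(n+d)}$, $\lambda\in[0,\rho^2]$ and $r\in\mathbb{R}$ such that, with $\widetilde A=A+BMC$, one has $C(\widetilde A-I_n)^{-1}BM=I_d$ and $$E^T\begin{pmatrix}-\rho^2P_{11}&-\rho^2P_{12}&0&0\\ -\rho^2P_{21}&-\rho^2P_{22}&0&0\\ 0&0&P_{11}&P_{12}\\ 0&0&P_{21}&P_{22}\end{pmatrix}E+E^T\begin{pmatrix}0&0&0&-\frac{\lambda}{2}C^T\\ 0&-r\Pi&0&\frac{\lambda}{2}\widetilde L^\dagger\\ 0&0&0&\frac12C^T\\ -\frac{\lambda}{2}C&\frac{\lambda}{2}\widetilde L^\dagger&\frac12C&-\widetilde L^\dagger-r\Pi\end{pmatrix}E\prec0,\qquad E=\begin{pmatrix}I_n&0&0\\ 0&I_d&0\\ \widetilde A&B&0\\ 0&0&I_d\end{pmatrix}.$$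 (b) (Synthesis conditions) There exist $\hat A\in\mathbb{R}^{n\times n}$, $\hat B\in\mathbb{R}^{n\times d}$, $C\in\mathbb{R}^{d\times n}$, a symmetric $P\in\mathbb{R}^{(n+d)\times(n+d)}$, $r\in\mathbb{R}$ and $\lambda\in[0,\rho^2]$ such that $$\begin{pmatrix}-\rho^2P_{11}&-\rho^2P_{12}&*&*&*\\ -\rho^2P_{21}&-\rho^2P_{22}-r\Pi&*&*&*\\ \frac12J_2\hat A-\frac{\lambda}{2}C&\frac12J_2\hat B+\frac{\lambda}{2}\widetilde L^\dagger&-\widetilde L^\dagger-r\Pi&*&*\\ \hat A&\hat B&P_{12}&-P_{11}&-P_{12}\\ J_3\hat A&J_3\hat B&P_{22}&-P_{21}&-P_{22}\end{pmatrix}\prec0$$ and $$\hat B=(\hat A-P_{11})J_1^TM^{-1},\qquad CJ_1^T=I_d,\qquad C=J_2P_{11},\qquad P_{21}=J_3P_{11}.$$ Moreover, from any solution of (b), algorithm parameters $(A,B,C)$ for which the conditions in (a) are feasible are obtained by keeping $C$ and setting $$B=P_{11}^{-1}\hat B,\qquad A=P_{11}^{-1}\hat A-BMC.$$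
   Context: $P$ is partitioned as $P=\begin{pmatrix}P_{11}&P_{12}\\ P_{21}&P_{22}\end{pmatrix}$ with $P_{11}\in\mathbb{R}^{n\times n}$, $P_{22}\in\mathbb{R}^{d\times d}$. The symbols $*$ denote the blocks determined by symmetry of the matrix. $\preceq,\prec$ denote the Loewner order on symmetric matrices ($X\prec0$: negative definite). $X^\dagger$ is the Moore–Penrose pseudoinverse and $\Pi_{\ker X}$ the orthogonal projection matrix onto $\ker X$. A condition containing an inverse includes the requirement that the inverse exists (so both (a) and (b) include non-singularity of $M$). *)

(* Defs.v *)
From HB Require Import structures.
From mathcomp Require Import all_boot all_order all_algebra.
From mathcomp Require Import boolp classical_sets reals.

Set Implicit Arguments.
Unset Strict Implicit.
Unset Printing Implicit Defensive.

Import Order.TTheory GRing.Theory Num.Theory.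
Local Open Scope ring_scope.

Section Definite.
Context {R : realType} {n : nat}.
Implicit Types X Y : 'M[R]_n.

(* Symmetry is part of (semi)definiteness. *)
Definition psdmx X : Prop :=
  X \is symmetricmx /\ forall v : 'cV[R]_n, 0 <= (v^T *m X *m v) 0 0.

Definition posdefmx X : Prop :=
  X \is symmetricmx /\
  forall v : 'cV[R]_n, v != 0 -> 0 < (v^T *m X *m v) 0 0.

Definition negdefmx X : Prop := posdefmx (- X).

Definition loewner_le X Y : Prop := psdmx (Y - X).

Lemma symmetricmxP X : reflect (X^T = X) (X \is symmetricmx).
Proof.
by apply: (iffP (is_hermitianmxP _ _ _)); rewrite /= expr0 scale1r map_mx_id.
Qed.

End Definite.

Section PseudoInverse.
Context {R : realType}.

Definition moore_penrose m n (X : 'M[R]_(m, n)) (Y : 'M[R]_(n, m)) : Prop :=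
  [/\ X *m Y *m X = X, Y *m X *m Y = Y,
      (X *m Y)^T = X *m Y & (Y *m X)^T = Y *m X].

(* The Moore-Penrose pseudoinverse, unique solution of the Penrose equations
   ([mp_pinvP], [moore_penrose_uniq]).  It differs from [pinvmx], which is only
   a generalized inverse. *)
Definition mp_pinv m n (X : 'M[R]_(m, n)) : 'M[R]_(n, m) :=
  xget 0 [set Y | moore_penrose X Y].

Definition orthogonal_projector_ker m n (X : 'M[R]_(m, n)) (Q : 'M[R]_n) :
    Prop :=
  [/\ Q^T = Q, Q *m Q = Q
    & forall v : 'cV[R]_n, (exists u : 'cV[R]_n, v = Q *m u) <-> X *m v = 0].

(* The orthogonal projection matrix onto the column kernel { v | X v = 0 }
   ([orthproj_kerP], [orthogonal_projector_ker_uniq]). *)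
Definition orthproj_ker m n (X : 'M[R]_(m, n)) : 'M[R]_n :=
  xget 0 [set Q | orthogonal_projector_ker X Q].

Lemma mulmx_tr_eq0 n (v : 'rV[R]_n) : v *m v^T = 0 -> v = 0.
Proof.
move=> /matrixP/(_ 0 0); rewrite !mxE => /eqP.
rewrite psumr_eq0 => [/allP v0|i _]; last by rewrite mxE -expr2 sqr_ge0.
apply/rowP => i; have := v0 i; rewrite mem_index_enum => /(_ isT) /=.
by rewrite !mxE mulf_eq0 orbb => /eqP.
Qed.

Lemma gram_unitmx m n (G : 'M[R]_(m, n)) : row_free G -> G *m G^T \in unitmx.
Proof.
move=> Gfree; rewrite -row_free_unit -kermx_eq0; apply/eqP/row_matrixP => i.
rewrite row0; set v := row i _.
have v0 : v *m (G *m G^T) = 0 by rewrite -row_mul mulmx_ker row0.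
suff vG0 : v *m G = 0 by apply: (row_free_inj Gfree); rewrite vG0 mul0mx.
by apply: mulmx_tr_eq0; rewrite trmx_mul mulmxA -(mulmxA v) v0 mul0mx.
Qed.

Lemma moore_penrose_uniq m n (X : 'M[R]_(m, n)) (Y Z : 'M[R]_(n, m)) :
  moore_penrose X Y -> moore_penrose X Z -> Y = Z.
Proof.
move=> [Y1 Y2 Y3 Y4] [Z1 Z2 Z3 Z4].
have XYZ : X *m Y = X *m Z.
  have E : (X *m Z) *m (X *m Y) = X *m Y by rewrite mulmxA Z1.
  by rewrite -Y3 -E trmx_mul Y3 Z3 mulmxA Y1.
have YZX : Y *m X = Z *m X.
  have E : (Y *m X) *m (Z *m X) = Y *m X by rewrite -mulmxA (mulmxA X) Z1.
  by rewrite -Y4 -E trmx_mul Y4 Z4 -mulmxA (mulmxA X) Y1.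
by rewrite -Y2 YZX -mulmxA XYZ mulmxA Z2.
Qed.

Lemma moore_penrose_mulmx m n r (F : 'M[R]_(m, r)) (G : 'M[R]_(r, n)) :
  F^T *m F \in unitmx -> G *m G^T \in unitmx ->
  moore_penrose (F *m G) (G^T *m invmx (G *m G^T) *m (invmx (F^T *m F) *m F^T)).
Proof.
set H := G^T *m _; set K := _ *m F^T => Fu Gu.
have GH : G *m H = 1%:M by rewrite mulmxA mulmxV.
have KF : K *m F = 1%:M by rewrite -mulmxA mulVmx.
have XY : F *m G *m (H *m K) = F *m K by rewrite -mulmxA (mulmxA G) GH mul1mx.
have YX : H *m K *m (F *m G) = H *m G by rewrite -mulmxA (mulmxA K) KF mul1mx.
split.
- by rewrite XY -mulmxA (mulmxA K) KF mul1mx.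
- by rewrite YX -mulmxA (mulmxA G) GH mul1mx.
- by rewrite XY !trmx_mul trmxK trmx_inv trmx_mul trmxK mulmxA.
- by rewrite YX !trmx_mul trmxK trmx_inv trmx_mul trmxK mulmxA.
Qed.

Lemma moore_penrose_ex m n (X : 'M[R]_(m, n)) : exists Y, moore_penrose X Y.
Proof.
have Gu := gram_unitmx (row_base_free X).
have Fu : (col_base X)^T *m col_base X \in unitmx.
  rewrite -{2}(trmxK (col_base X)); apply: gram_unitmx.
  by rewrite /row_free mxrank_tr; exact: col_base_full.
by rewrite -{1}(mulmx_base X); eexists; exact: moore_penrose_mulmx Fu Gu.
Qed.

Lemma mp_pinvP m n (X : 'M[R]_(m, n)) : moore_penrose X (mp_pinv X).
Proof. exact: (xgetPex 0 (moore_penrose_ex X)). Qed.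

Lemma orthogonal_projector_ker_ex m n (X : 'M[R]_(m, n)) :
  exists Q, orthogonal_projector_ker X Q.
Proof.
have [X1 X2 X3 X4] := mp_pinvP X; set Y := mp_pinv X in X1 X2 X3 X4.
exists (1%:M - Y *m X); split.
- by rewrite linearB /= trmx1 X4.
- by rewrite mulmxBr mulmx1 mulmxBl mul1mx mulmxA X2 subrr subr0.
- move=> v; split=> [[u ->]|Xv0].
    by rewrite mulmxA mulmxBr mulmx1 mulmxA X1 subrr mul0mx.
  by exists v; rewrite mulmxBl mul1mx -mulmxA Xv0 mulmx0 subr0.
Qed.

Lemma orthproj_kerP m n (X : 'M[R]_(m, n)) :
  orthogonal_projector_ker X (orthproj_ker X).
Proof. exact: (xgetPex 0 (orthogonal_projector_ker_ex X)). Qed.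

Lemma orthogonal_projector_ker_uniq m n (X : 'M[R]_(m, n)) (Q Q' : 'M[R]_n) :
  orthogonal_projector_ker X Q -> orthogonal_projector_ker X Q' -> Q = Q'.
Proof.
have aux (S S' : 'M[R]_n) : orthogonal_projector_ker X S ->
    orthogonal_projector_ker X S' -> S' *m S = S.
  move=> [_ _ S3] [_ S2' S3']; apply/trmx_inj/row_matrixP => j.
  rewrite -!tr_col !colE; congr (_^T).
  have /S3/S3'[u uE] : exists u : 'cV[R]_n, S *m delta_mx j 0 = S *m u by eexists.
  by rewrite -mulmxA uE mulmxA S2'.
move=> hQ hQ'; have := aux _ _ hQ hQ'; have := aux _ _ hQ' hQ.
case: hQ hQ' => [T _ _] [T' _ _] E <-.
by rewrite -{1}T' -{1}T -trmx_mul E T'.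
Qed.

End PseudoInverse.

Section Conditions.
Context {R : realType} {d n : nat}.

(* The d x n matrix (0 .. 0 I_d 0) with k zero blocks of size d x d on the left;
   J_1, J_2, J_3 are the cases k = 0, 1, 2. *)
Definition selmx (k : nat) : 'M[R]_(d, n) :=
  \matrix_(i < d, j < n) (j == k * d + i :> nat)%N%:R.

Definition J1 : 'M[R]_(d, n) := selmx 0.
Definition J2 : 'M[R]_(d, n) := selmx 1.
Definition J3 : 'M[R]_(d, n) := selmx 2.

Context (M L : 'M[R]_d) (rho : R).

Let Lt := mp_pinv (L - M).
Let Pi := orthproj_ker (L - M).

Definition storage_mx (P : 'M[R]_(n + d)) :
    'M[R]_(n + (d + (n + d)), n + (d + (n + d))) :=
  let P11 := ulsubmx P in let P12 := ursubmx P in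
  let P21 := dlsubmx P in let P22 := drsubmx P in
  col_mx (row_mx (- rho ^+ 2 *: P11) (row_mx (- rho ^+ 2 *: P12)
           (row_mx 0                  0)))
 (col_mx (row_mx (- rho ^+ 2 *: P21) (row_mx (- rho ^+ 2 *: P22)
           (row_mx 0                  0)))
 (col_mx (row_mx 0                   (row_mx 0
           (row_mx P11                P12)))
         (row_mx 0                   (row_mx 0
           (row_mx P21                P22))))).

Definition multiplier_mx (C : 'M[R]_(d, n)) (lam r : R) :
    'M[R]_(n + (d + (n + d)), n + (d + (n + d))) :=
  col_mx (row_mx 0 (row_mx 0 (row_mx 0 (- (lam / 2) *: C^T))))
 (col_mx (row_mx 0 (row_mx (- r *: Pi) (row_mx 0 ((lam / 2) *: Lt))))
 (col_mx (row_mx 0 (row_mx 0 (row_mx 0 (2^-1 *: C^T))))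
         (row_mx (- (lam / 2) *: C) (row_mx ((lam / 2) *: Lt)
           (row_mx (2^-1 *: C) (- Lt - r *: Pi)))))).

Definition outer_mx (At : 'M[R]_n) (B : 'M[R]_(n, d)) :
    'M[R]_(n + (d + (n + d)), n + (d + d)) :=
  col_mx (row_mx 1%:M (row_mx 0    0))
 (col_mx (row_mx 0    (row_mx 1%:M 0))
 (col_mx (row_mx At   (row_mx B    0))
         (row_mx 0    (row_mx 0    1%:M)))).

(* [invmx] is total, so the existence of an inverse is stated separately. *)
Definition analysis_conditions (A : 'M[R]_n) (B : 'M[R]_(n, d))
    (C : 'M[R]_(d, n)) (P : 'M[R]_(n + d)) (lam r : R) : Prop :=
  let At := A + B *m M *m C in
  let E := outer_mx At B in
  [/\ posdefmx P,
      0 <= lam <= rho ^+ 2,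
      At - 1%:M \in unitmx,
      C *m invmx (At - 1%:M) *m B *m M = 1%:M
    & negdefmx (E^T *m storage_mx P *m E + E^T *m multiplier_mx C lam r *m E)].

Definition analysis_feasible (A : 'M[R]_n) (B : 'M[R]_(n, d))
    (C : 'M[R]_(d, n)) : Prop :=
  exists (P : 'M[R]_(n + d)) (lam r : R), analysis_conditions A B C P lam r.

Definition synthesis_mx (Ah : 'M[R]_n) (Bh : 'M[R]_(n, d)) (C : 'M[R]_(d, n))
    (P : 'M[R]_(n + d)) (r lam : R) :
    'M[R]_(n + (d + (d + (n + d))), n + (d + (d + (n + d)))) :=
  let P11 := ulsubmx P in let P12 := ursubmx P in
  let P21 := dlsubmx P in let P22 := drsubmx P in
  let X31 := 2^-1 *: (J2 *m Ah) - (lam / 2) *: C in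
  let X32 := 2^-1 *: (J2 *m Bh) + (lam / 2) *: Lt in
  let X51 := J3 *m Ah in
  let X52 := J3 *m Bh in
  col_mx (row_mx (- rho ^+ 2 *: P11) (row_mx (- rho ^+ 2 *: P12)
           (row_mx X31^T (row_mx Ah^T X51^T))))
 (col_mx (row_mx (- rho ^+ 2 *: P21) (row_mx (- rho ^+ 2 *: P22 - r *: Pi)
           (row_mx X32^T (row_mx Bh^T X52^T))))
 (col_mx (row_mx X31 (row_mx X32
           (row_mx (- Lt - r *: Pi) (row_mx P12^T P22^T))))
 (col_mx (row_mx Ah (row_mx Bh
           (row_mx P12 (row_mx (- P11) (- P12)))))
         (row_mx X51 (row_mx X52
           (row_mx P22 (row_mx (- P21) (- P22)))))))).

Definition synthesis_conditions (Ah : 'M[R]_n) (Bh : 'M[R]_(n, d))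
    (C : 'M[R]_(d, n)) (P : 'M[R]_(n + d)) (r lam : R) : Prop :=
  [/\ P \is symmetricmx, 0 <= lam <= rho ^+ 2
    & negdefmx (synthesis_mx Ah Bh C P r lam)] /\
  [/\ M \in unitmx,
      Bh = (Ah - ulsubmx P) *m J1^T *m invmx M,
      C *m J1^T = 1%:M,
      C = J2 *m ulsubmx P
    & dlsubmx P = J3 *m ulsubmx P].

End Conditions.

(* Main.v *)
(* A Schur complement with respect to P turns the synthesis inequality into the
   analysis inequality together with P > 0: completing the square, the synthesis
   form at (x, y, u, p, q) is the analysis form at (x, y, u) minus the P-norm of
   (p, q) - (At x + B y, u), once C = J2 P11 and P21 = J3 P11.  Evaluating the
   analysis form at y = u = 0 with At x = x contradicts rho < 1, so At - I is
   invertible.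

   Conversely, with K = (At - I)^-1 B M one has C K = I, and a change of state
   x = T z reaches the structured form as soon as the first three block columns
   of T are K, P11^-1 C^T and P11^-1 P12.  These columns may be dependent, but
   they become part of an invertible T after an arbitrarily small shift T + e I,
   and moving K, C, P12 along with T preserves the strict inequalities. *)
Require Import Defs.
From HB Require Import structures.
From mathcomp Require Import all_boot all_order all_algebra.
From mathcomp Require Import boolp classical_sets reals.
From mathcomp Require Import topology normedtype.
From mathcomp Require Import ring lra.

Set Implicit Arguments.
Unset Strict Implicit.
Unset Printing Implicit Defensive.

Import Order.TTheory GRing.Theory Num.Theory.
Import numFieldTopology.Exports numFieldNormedType.Exports.
Local Open Scope ring_scope.

(** * The scalar product of column vectors *)

Section Dot.
Context {R : realType}.

Definition dot n (a b : 'cV[R]_n) : R := (a^T *m b) 0 0.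

Lemma dotE n (X : 'M[R]_n) v : (v^T *m X *m v) 0 0 = dot v (X *m v).
Proof. by rewrite /dot mulmxA. Qed.

Lemma dotC n (a b : 'cV[R]_n) : dot a b = dot b a.
Proof. by rewrite /dot -[in RHS](trmxK a) -trmx_mul [RHS]mxE. Qed.

Lemma dotDr n (a b c : 'cV[R]_n) : dot a (b + c) = dot a b + dot a c.
Proof. by rewrite /dot mulmxDr mxE. Qed.

Lemma dotDl n (a b c : 'cV[R]_n) : dot (a + b) c = dot a c + dot b c.
Proof. by rewrite dotC dotDr !(dotC c). Qed.

Lemma dotZr n k (a b : 'cV[R]_n) : dot a (k *: b) = k * dot a b.
Proof. by rewrite /dot -scalemxAr mxE. Qed.

Lemma dotZl n k (a b : 'cV[R]_n) : dot (k *: a) b = k * dot a b.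
Proof. by rewrite dotC dotZr dotC. Qed.

Lemma dotNr n (a b : 'cV[R]_n) : dot a (- b) = - dot a b.
Proof. by rewrite -scaleN1r dotZr mulN1r. Qed.

Lemma dotNl n (a b : 'cV[R]_n) : dot (- a) b = - dot a b.
Proof. by rewrite dotC dotNr dotC. Qed.

Lemma dot0r n (a : 'cV[R]_n) : dot a 0 = 0.
Proof. by rewrite /dot mulmx0 mxE. Qed.

Lemma dot_col m n (a c : 'cV[R]_m) (b d : 'cV[R]_n) :
  dot (col_mx a b) (col_mx c d) = dot a c + dot b d.
Proof. by rewrite /dot tr_col_mx mul_row_col mxE. Qed.

Lemma dot_tr m n (X : 'M[R]_(m, n)) a b : dot a (X^T *m b) = dot b (X *m a).
Proof. by rewrite dotC /dot trmx_mul trmxK mulmxA. Qed.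

Lemma dot_deltal n (i : 'I_n) (a : 'cV[R]_n) : dot (delta_mx i 0) a = a i 0.
Proof. by rewrite /dot trmx_delta -rowE mxE. Qed.

Lemma dot_sum n (a b : 'cV[R]_n) : dot a b = \sum_i a i 0 * b i 0.
Proof. by rewrite /dot mxE; apply: eq_bigr => i _; rewrite mxE. Qed.

End Dot.

(** * Definite matrices: congruence, coercivity and entrywise perturbation bounds *)

Section Definiteness.
Context {R : realType}.

Lemma posdefmxE n (X : 'M[R]_n) : posdefmx X <->
  X^T = X /\ forall v, v != 0 -> 0 < dot v (X *m v).
Proof.
split=> [[/symmetricmxP sX pX]|[sX pX]].
  by split=> // v v0; rewrite -dotE pX.
by split=> [|v v0]; [exact/symmetricmxP | rewrite dotE pX].
Qed.

Lemma negdefmxE n (X : 'M[R]_n) : negdefmx X <->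
  X^T = X /\ forall v, v != 0 -> dot v (X *m v) < 0.
Proof.
rewrite /negdefmx posdefmxE; split=> -[sX nX]; split.
- by apply: oppr_inj; rewrite -linearN.
- by move=> v /nX; rewrite mulNmx dotNr oppr_gt0.
- by rewrite linearN /= sX.
- by move=> v /nX; rewrite mulNmx dotNr oppr_gt0.
Qed.

Lemma singular_ker n (X : 'M[R]_n) :
  X \notin unitmx -> exists2 v : 'cV[R]_n, v != 0 & X *m v = 0.
Proof.
rewrite -unitmx_tr unitmxE unitfE negbK => /det0P[v v0 vX].
exists v^T; first by rewrite -(inj_eq trmx_inj) trmxK trmx0.
by apply: trmx_inj; rewrite trmx_mul trmxK vX trmx0.
Qed.

Lemma posdefmx_unit n (X : 'M[R]_n) : posdefmx X -> X \in unitmx.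
Proof.
move=> /posdefmxE[_ pX]; apply: contraT => /singular_ker[v /pX].
by move=> /[swap] ->; rewrite dot0r ltxx.
Qed.

Lemma posdefmx_ge0 n (X : 'M[R]_n) v : posdefmx X -> 0 <= dot v (X *m v).
Proof.
move=> /posdefmxE[_ pX]; have [->|/pX/ltW//] := eqVneq v 0.
by rewrite mulmx0 dot0r.
Qed.

Lemma posdefmx_congr n (X T : 'M[R]_n) :
  T \in unitmx -> posdefmx X -> posdefmx (T^T *m X *m T).
Proof.
move=> Tu /posdefmxE[sX pX]; apply/posdefmxE; split.
  by rewrite !trmx_mul trmxK sX mulmxA.
move=> v v0; rewrite -!mulmxA dot_tr dotC pX //.
by apply: contraNneq v0 => Tv; rewrite -[v](mulKmx Tu) Tv mulmx0.
Qed.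

Lemma posdefmx_ul n m (P : 'M[R]_(n + m)) : posdefmx P -> posdefmx (ulsubmx P).
Proof.
move=> /posdefmxE[sP pP]; apply/posdefmxE; split.
  by rewrite trmx_ulsub sP.
move=> v v0; have /pP : col_mx v (0 : 'cV[R]_m) != 0.
  by rewrite col_mx_eq0 negb_and v0.
rewrite -{1}[P]submxK mul_block_col !mulmx0 !addr0 dot_col.
by rewrite [X in _ + X]dotC dot0r addr0.
Qed.

(* Cauchy-Schwarz for the inner product of [X], against [X^-1 e_i]. *)
Lemma posdefmx_coercive n (X : 'M[R]_n) : posdefmx X ->
  exists2 c : R, 0 < c & forall v, dot v v <= c * dot v (X *m v).
Proof.
move=> hX; have Xu := posdefmx_unit hX; have [sX pX] := (posdefmxE X).1 hX.
pose w (i : 'I_n) : 'cV[R]_n := invmx X *m delta_mx i 0.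
have Xw i : X *m w i = delta_mx i 0 by rewrite mulmxA mulmxV // mul1mx.
pose g i := dot (w i) (X *m w i).
have g0 i : 0 <= g i by exact: posdefmx_ge0.
(* The [g i] are the diagonal entries of the inverse of [X]; [c] bounds them all, and the added 1
   allows division by it. *)
pose c := 1 + \sum_i g i.
have c1 : 1 <= c by rewrite lerDl sumr_ge0.
have gc i : g i <= c.
  by rewrite /c (bigD1 i) //= addrCA lerDl addr_ge0 // sumr_ge0.
have c0 : 0 < c by exact: lt_le_trans c1.
have bnd (v : 'cV[R]_n) i : v i 0 ^+ 2 <= c * dot v (X *m v).
  (* The minimiser in [t] of the expanded quadratic once [g i] is replaced by its bound [c]. *)
  pose t := v i 0 / c.
  have := posdefmx_ge0 (v - t *: w i) hX.
  have E : dot (v - t *: w i) (X *m (v - t *: w i)) =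
      dot v (X *m v) - 2 * t * v i 0 + t ^+ 2 * g i.
    rewrite mulmxBr -scalemxAr !dotDl !dotDr !dotNl !dotNr.
    rewrite !dotZl !dotZr -/(g i).
    have -> : dot (w i) (X *m v) = v i 0.
      by rewrite -{1}sX dot_tr Xw dotC dot_deltal.
    have -> : dot v (X *m w i) = v i 0 by rewrite Xw dotC dot_deltal.
    ring.
  rewrite E => h.
  have tc : t * c = v i 0 by rewrite /t mulfVK // gt_eqF.
  have : t ^+ 2 * g i <= t ^+ 2 * c by rewrite ler_wpM2l ?sqr_ge0.
  move=> tgc; have qc : t ^+ 2 * c <= dot v (X *m v) by rewrite -tc in h; lra.
  have -> : v i 0 ^+ 2 = c * (t ^+ 2 * c) by rewrite -tc; ring.
  by rewrite ler_wpM2l // ltW.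
exists (n%:R * c + 1); first by rewrite ltr_wpDl // mulr_ge0 // ltW.
move=> v; rewrite mulrDl mul1r.
have : dot v v <= \sum_(i < n) c * dot v (X *m v).
  by rewrite dot_sum; apply: ler_sum => i _; rewrite -expr2.
rewrite sumr_const card_ord => /le_trans; apply.
by rewrite -[X in X <= _]mulr_natl mulrA lerDl posdefmx_ge0.
Qed.

(** Bounding each [|v_i v_j|] by [(v_i^2 + v_j^2) / 2] and summing over both indices produces the
    factor [n]. *)
Lemma dot_le_entries n (D : 'M[R]_n) (e : R) v : (forall i j, `|D i j| <= e) ->
  `|dot v (D *m v)| <= e * n%:R * dot v v.
Proof.
move=> De.
have -> : dot v (D *m v) = \sum_i \sum_j v i 0 * (D i j * v j 0).
  by rewrite dot_sum; apply: eq_bigr => i _; rewrite mxE mulr_sumr.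
apply: (@le_trans _ _ (\sum_i \sum_j e * ((v i 0 ^+ 2 + v j 0 ^+ 2) / 2))).
  apply: (le_trans (ler_norm_sum _ _ _)); apply: ler_sum => i _.
  apply: (le_trans (ler_norm_sum _ _ _)); apply: ler_sum => j _.
  rewrite mulrCA normrM ler_pM //.
  rewrite normrM -[v i 0 ^+ 2]real_normK ?num_real //.
  rewrite -[v j 0 ^+ 2]real_normK ?num_real //.
  have := sqr_ge0 (`|v i 0| - `|v j 0|); rewrite sqrrB; lra.
have -> : dot v v = \sum_i v i 0 ^+ 2.
  by rewrite dot_sum; under [RHS]eq_bigr do rewrite expr2.
set S := \sum_i _ ^+ 2.
have inner i : \sum_j e * ((v i 0 ^+ 2 + v j 0 ^+ 2) / 2) =
    e * ((n%:R * v i 0 ^+ 2 + S) / 2).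
  by rewrite -mulr_sumr -mulr_suml big_split /= sumr_const card_ord mulr_natl.
under eq_bigr do rewrite inner.
rewrite -mulr_sumr -mulr_suml big_split /= sumr_const card_ord -mulr_sumr -/S.
by rewrite -[S *+ n]mulr_natl le_eqVlt; apply/orP; left; apply/eqP; field.
Qed.

End Definiteness.

(** * The quadratic forms of the analysis and synthesis matrices *)

Section Forms.
Context {R : realType} {d n : nat}.
Implicit Types (M L : 'M[R]_d) (rho lam r : R) (At : 'M[R]_n).
Implicit Types (B : 'M[R]_(n, d)) (C : 'M[R]_(d, n)) (P : 'M[R]_(n + d)).

(** [At] is a free argument because [A] enters the inequality only through [A + B M C]. *)
Definition analysis_mx M L rho At B C P lam r : 'M[R]_(n + (d + d)) :=
  (outer_mx At B)^T *m storage_mx rho P *m outer_mx At B +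
  (outer_mx At B)^T *m multiplier_mx M L C lam r *m outer_mx At B.

Definition storage P (x : 'cV[R]_n) (y : 'cV[R]_d) : R :=
  dot (col_mx x y) (P *m col_mx x y).

(* The quadratic form of [analysis_mx] at [(x, y, u)], with [At x + B y]
   abstracted as [s]. *)
Definition dissipation M L rho C P lam r (x s : 'cV[R]_n)
    (y u : 'cV[R]_d) : R :=
  storage P s u - rho ^+ 2 * storage P x y
  + dot u (C *m s) - lam * dot u (C *m x)
  + lam * dot u (mp_pinv (L - M) *m y) - dot u (mp_pinv (L - M) *m u)
  - r * (dot y (orthproj_ker (L - M) *m y) + dot u (orthproj_ker (L - M) *m u)).

(** For symmetric [X], transposing a solution of the Penrose equations gives another solution, so
    uniqueness applies. *)
Lemma mp_pinv_sym m (X : 'M[R]_m) : X^T = X -> (mp_pinv X)^T = mp_pinv X.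
Proof.
move=> sX; have [X1 X2 X3 X4] := mp_pinvP X.
apply: (@moore_penrose_uniq _ _ _ X); last exact: mp_pinvP.
split.
- by rewrite -[in RHS]sX -[in RHS]X1 !trmx_mul sX mulmxA.
- by rewrite -[in RHS]X2 !trmx_mul sX mulmxA.
- by rewrite trmx_mul trmxK sX -X4 trmx_mul sX.
- by rewrite trmx_mul trmxK sX -X3 trmx_mul sX.
Qed.

Lemma storageE P x y : storage P x y =
  dot x (ulsubmx P *m x) + dot x (ursubmx P *m y) +
  (dot y (dlsubmx P *m x) + dot y (drsubmx P *m y)).
Proof. by rewrite /storage -{1}[P]submxK mul_block_col dot_col !dotDr. Qed.

(** Symmetry of [P] merges the two cross terms; this expansion completes the square in
    [synthesis_form]. *)
Lemma storage_add P x y x' y' : P^T = P ->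
  storage P (x - x') (y - y') = storage P x y + storage P x' y'
    - 2 * (dot x (ulsubmx P *m x' + ursubmx P *m y') +
           dot y (dlsubmx P *m x' + drsubmx P *m y')).
Proof.
move=> sP; rewrite -dot_col -mul_block_col submxK /storage.
rewrite -[col_mx (_ - _) _]add_col_mx -opp_col_mx.
set v := col_mx x y; set w := col_mx x' y'.
have wv : dot w (P *m v) = dot v (P *m w) by rewrite -{1}sP dot_tr.
rewrite mulmxBr !dotDl !dotDr !dotNl !dotNr wv; ring.
Qed.

Lemma analysis_form M L rho At B C P lam r x y u : (L - M)^T = L - M ->
  let v := col_mx x (col_mx y u) in
  dot v (analysis_mx M L rho At B C P lam r *m v) =
    dissipation M L rho C P lam r x (At *m x + B *m y) y u.
Proof.
move=> sLM v; rewrite /analysis_mx -mulmxDl -mulmxDr -!mulmxA dot_tr dotC.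
have -> : outer_mx At B *m v =
    col_mx x (col_mx y (col_mx (At *m x + B *m y) u)).
  rewrite /outer_mx /v !mul_col_mx !mul_row_col.
  by rewrite !mul0mx !mul1mx !addr0 !add0r.
set s := _ + _.
rewrite mulmxDl dotDr /storage_mx /multiplier_mx !mul_col_mx !mul_row_col.
rewrite !mul0mx ?addr0 ?add0r !dot_col ?dot0r !dotDr.
rewrite !mulmxBl !mulNmx -!scalemxAl !dotDr !dotNr !dotZr !dot_tr.
have -> : dot y (mp_pinv (L - M) *m u) = dot u (mp_pinv (L - M) *m y).
  by rewrite -{1}(mp_pinv_sym sLM) dot_tr.
by rewrite /dissipation !storageE; field.
Qed.

(** The two relations turn the blocks built with [J2] and [J3] into [C s] and [P21 s], so the terms
    in [(p, q)] pair it with [P (s, u)] and the square closes around [(s, u)]. *)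
Lemma synthesis_form M L rho At B C P r lam x y u p q :
  P^T = P -> C = J2 *m ulsubmx P -> dlsubmx P = J3 *m ulsubmx P ->
  let s := At *m x + B *m y in
  let v := col_mx x (col_mx y (col_mx u (col_mx p q))) in
  dot v (synthesis_mx M L rho (ulsubmx P *m At) (ulsubmx P *m B) C P r lam *m v) =
    dissipation M L rho C P lam r x s y u - storage P (p - s) (q - u).
Proof.
move=> sP CE P21 s v.
rewrite /synthesis_mx !mulmxA -P21 -CE /v !mul_col_mx !mul_row_col !dot_col.
rewrite !dotDr !dot_tr !(mulmxDl, mulmxBl, mulNmx) -!scalemxAl -!mulmxA.
rewrite !dotDr !dotNr !dotZr.
rewrite storage_add // /dissipation /s !storageE.
by rewrite !mulmxDr !dotDr; field.
Qed.

Lemma orthproj_ker_sym m (X : 'M[R]_m) : (orthproj_ker X)^T = orthproj_ker X.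
Proof. by case: (orthproj_kerP X). Qed.

Lemma trmxZ m1 m2 a (X : 'M[R]_(m1, m2)) : (a *: X)^T = a *: X^T.
Proof. exact: linearZ. Qed.

Lemma trmxB m1 m2 (X Y : 'M[R]_(m1, m2)) : (X - Y)^T = X^T - Y^T.
Proof. exact: linearB. Qed.

Lemma trmxN m1 m2 (X : 'M[R]_(m1, m2)) : (- X)^T = - X^T.
Proof. exact: linearN. Qed.

Lemma row_mx_col m1 m2 n1 n2 (X1 : 'M[R]_(m1, n1)) (X2 : 'M[R]_(m1, n2))
    (X3 : 'M[R]_(m2, n1)) (X4 : 'M[R]_(m2, n2)) :
  row_mx (col_mx X1 X3) (col_mx X2 X4) = col_mx (row_mx X1 X2) (row_mx X3 X4).
Proof. by rewrite -block_mxEh block_mxEv. Qed.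

Lemma tr_submx P : P^T = P ->
  [/\ (ulsubmx P)^T = ulsubmx P, (ursubmx P)^T = dlsubmx P,
      (dlsubmx P)^T = ursubmx P & (drsubmx P)^T = drsubmx P].
Proof.
by move=> sP; rewrite trmx_ulsub trmx_ursub trmx_dlsub trmx_drsub sP.
Qed.

Lemma tr_analysis_mx M L rho At B C P lam r : (L - M)^T = L - M -> P^T = P ->
  (analysis_mx M L rho At B C P lam r)^T = analysis_mx M L rho At B C P lam r.
Proof.
move=> sLM sP; rewrite /analysis_mx linearD /= !trmx_mul !trmxK !mulmxA.
have [P11 P12 P21 P22] := tr_submx sP.
congr (_ + _); (congr (_ *m _); congr (_ *m _)).
  rewrite /storage_mx !tr_col_mx !tr_row_mx !row_mx_col !trmxZ !trmx0.
  by rewrite P11 P12 P21 P22.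
rewrite /multiplier_mx !tr_col_mx !tr_row_mx !row_mx_col.
by rewrite !trmxB !trmxN !trmxZ !trmx0 !trmxK mp_pinv_sym // orthproj_ker_sym.
Qed.

Lemma tr_synthesis_mx M L rho Ah B C P r lam : (L - M)^T = L - M -> P^T = P ->
  (synthesis_mx M L rho Ah B C P r lam)^T = synthesis_mx M L rho Ah B C P r lam.
Proof.
move=> sLM sP; have [P11 P12 P21 P22] := tr_submx sP.
rewrite /synthesis_mx !tr_col_mx !tr_row_mx !row_mx_col !trmxK.
have -> : (- mp_pinv (L - M) - r *: orthproj_ker (L - M))^T =
    - mp_pinv (L - M) - r *: orthproj_ker (L - M).
  by rewrite trmxB trmxN trmxZ mp_pinv_sym // orthproj_ker_sym.
have -> : (- rho ^+ 2 *: drsubmx P - r *: orthproj_ker (L - M))^T =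
    - rho ^+ 2 *: drsubmx P - r *: orthproj_ker (L - M).
  by rewrite trmxB !trmxZ P22 orthproj_ker_sym.
by rewrite !trmxZ !trmxN P11 P12 P21 P22.
Qed.

End Forms.

(** * Matrix families continuous at 0, and persistence of definiteness *)

Section ContinuousFamilies.
Context {R : realType}.

(** Continuity at the single point 0 suffices for the perturbation argument; for matrices it is
    taken entrywise. *)
Definition cts0 (f : R -> R) := (f e @[e --> (0 : R)] --> f 0)%classic.

Definition mxcts0 m n (F : R -> 'M[R]_(m, n)) :=
  forall i j, cts0 (fun e => F e i j).

Lemma cts0_sum I (r : seq I) (P : pred I) (f : I -> R -> R) :
  (forall i, P i -> cts0 (f i)) -> cts0 (fun e => \sum_(i <- r | P i) f i e).
Proof.
move=> fc; rewrite /cts0; apply: cvg_big => //; exact: add_continuous.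
Qed.

Lemma cts0_prod I (r : seq I) (P : pred I) (f : I -> R -> R) :
  (forall i, P i -> cts0 (f i)) -> cts0 (fun e => \prod_(i <- r | P i) f i e).
Proof.
move=> fc; rewrite /cts0; apply: cvg_big => //; exact: mul_continuous.
Qed.

Lemma mxcts0_cst m n (X : 'M[R]_(m, n)) : mxcts0 (fun=> X).
Proof. by move=> i j; exact: cvg_cst. Qed.

Lemma mxcts0D m n (F G : R -> 'M[R]_(m, n)) :
  mxcts0 F -> mxcts0 G -> mxcts0 (fun e => F e + G e).
Proof.
move=> Fc Gc i j; rewrite /cts0 mxE; under eq_fun do rewrite mxE.
exact: cvgD (Fc i j) (Gc i j).
Qed.

Lemma mxcts0N m n (F : R -> 'M[R]_(m, n)) : mxcts0 F -> mxcts0 (fun e => - F e).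
Proof.
move=> Fc i j; rewrite /cts0 mxE; under eq_fun do rewrite mxE.
exact: cvgN (Fc i j).
Qed.

Lemma mxcts0Z m n (f : R -> R) (F : R -> 'M[R]_(m, n)) :
  cts0 f -> mxcts0 F -> mxcts0 (fun e => f e *: F e).
Proof.
move=> fc Fc i j; rewrite /cts0 mxE; under eq_fun do rewrite mxE.
exact: cvgM fc (Fc i j).
Qed.

Lemma mxcts0M m n p (F : R -> 'M[R]_(m, n)) (G : R -> 'M[R]_(n, p)) :
  mxcts0 F -> mxcts0 G -> mxcts0 (fun e => F e *m G e).
Proof.
move=> Fc Gc i j; rewrite /cts0 mxE; under eq_fun do rewrite mxE.
apply: (@cts0_sum 'I_n _ predT (fun k e => F e i k * G e k j)) => k _.
exact: cvgM (Fc i k) (Gc k j).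
Qed.

Lemma mxcts0_tr m n (F : R -> 'M[R]_(m, n)) :
  mxcts0 F -> mxcts0 (fun e => (F e)^T).
Proof.
move=> Fc i j; rewrite /cts0 mxE; under eq_fun do rewrite mxE; exact: Fc.
Qed.

Lemma mxcts0_lsub m n1 n2 (F : R -> 'M[R]_(m, n1 + n2)) :
  mxcts0 F -> mxcts0 (fun e => lsubmx (F e)).
Proof.
move=> Fc i j; rewrite /cts0 mxE; under eq_fun do rewrite mxE; exact: Fc.
Qed.

Lemma mxcts0_rsub m n1 n2 (F : R -> 'M[R]_(m, n1 + n2)) :
  mxcts0 F -> mxcts0 (fun e => rsubmx (F e)).
Proof.
move=> Fc i j; rewrite /cts0 mxE; under eq_fun do rewrite mxE; exact: Fc.
Qed.

Lemma mxcts0_usub m1 m2 n (F : R -> 'M[R]_(m1 + m2, n)) :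
  mxcts0 F -> mxcts0 (fun e => usubmx (F e)).
Proof.
move=> Fc i j; rewrite /cts0 mxE; under eq_fun do rewrite mxE; exact: Fc.
Qed.

Lemma mxcts0_dsub m1 m2 n (F : R -> 'M[R]_(m1 + m2, n)) :
  mxcts0 F -> mxcts0 (fun e => dsubmx (F e)).
Proof.
move=> Fc i j; rewrite /cts0 mxE; under eq_fun do rewrite mxE; exact: Fc.
Qed.

Lemma mxcts0_row m n1 n2 (F : R -> 'M[R]_(m, n1)) (G : R -> 'M[R]_(m, n2)) :
  mxcts0 F -> mxcts0 G -> mxcts0 (fun e => row_mx (F e) (G e)).
Proof.
move=> Fc Gc i j; rewrite /cts0 mxE; under eq_fun do rewrite mxE.
by case: (split j) => k; [exact: Fc | exact: Gc].
Qed.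

Lemma mxcts0_col m1 m2 n (F : R -> 'M[R]_(m1, n)) (G : R -> 'M[R]_(m2, n)) :
  mxcts0 F -> mxcts0 G -> mxcts0 (fun e => col_mx (F e) (G e)).
Proof.
move=> Fc Gc i j; rewrite /cts0 mxE; under eq_fun do rewrite mxE.
by case: (split i) => k; [exact: Fc | exact: Gc].
Qed.

Lemma cts0_det n (F : R -> 'M[R]_n) : mxcts0 F -> cts0 (fun e => \det (F e)).
Proof.
move=> Fc; rewrite /determinant; apply: cts0_sum => s _.
by apply: cvgM; [exact: cvg_cst | apply: cts0_prod => i _; exact: Fc].
Qed.

Lemma mxcts0_adj n (F : R -> 'M[R]_n) :
  mxcts0 F -> mxcts0 (fun e => \adj (F e)).
Proof.
move=> Fc i j; rewrite /cts0 mxE; under eq_fun do rewrite mxE.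
apply: cvgM; first exact: cvg_cst.
apply: cts0_det => k l; rewrite /cts0 !mxE.
by under eq_fun do rewrite !mxE; exact: Fc.
Qed.

(** Coercivity of [F 0] absorbs the change of the form caused by a small entrywise perturbation,
    uniformly in [v]. *)
Lemma near_posdefmx n (F : R -> 'M[R]_n) : mxcts0 F ->
  (forall e, (F e)^T = F e) -> posdefmx (F 0) ->
  \forall e \near (0 : R), posdefmx (F e).
Proof.
move=> Fc sF hF; have [c c0 coer] := posdefmx_coercive hF.
have [_ pF] := (posdefmxE _).1 hF.
(* With entries moved by at most [1/k], the form loses at most the fraction [c n / k = 1 - 1/k] of
   its value and stays positive. *)
pose k : R := c * n%:R + 1.
have k0 : 0 < k by rewrite ltr_wpDl // mulr_ge0 // ltW.
have De : \forall e \near (0 : R), forall i j, `|F 0 i j - F e i j| <= k^-1.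
  pose D i j e := `|F 0 i j - F e i j| <= k^-1.
  have Dij i j : nbhs (0 : R) (D i j).
    by have /cvgrPdist_le := Fc i j; apply; rewrite invr_gt0.
  apply: (@filter_forall _ _ (fun i e => forall j, D i j e) (nbhs (0 : R))) => i.
  by apply: (@filter_forall _ _ (D i) (nbhs (0 : R))) => j; exact: Dij.
near=> e; apply/posdefmxE; split => // v v0.
have De' : forall i j, `|F 0 i j - F e i j| <= k^-1 by near: e; exact: De.
have D' i j : `|(F 0 - F e) i j| <= k^-1 by rewrite !mxE; exact: De'.
have := dot_le_entries v D'; have := coer v; have := pF v v0.
rewrite mulmxBl dotDr dotNr.
set q := dot v (F 0 *m v); set q' := dot v (F e *m v) => q0 vq /ler_normlP[_].
have kn : 0 <= k^-1 * n%:R by rewrite mulr_ge0 // invr_ge0 ltW.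
have : k^-1 * n%:R * dot v v <= k^-1 * n%:R * (c * q) by rewrite ler_wpM2l.
have -> : k^-1 * n%:R * (c * q) = q - k^-1 * q.
  by rewrite /k; field; rewrite gt_eqF.
have : 0 < k^-1 * q by rewrite mulr_gt0 // invr_gt0.
lra.
Unshelve. all: end_near.
Qed.

(** The shift [X + e I] is singular only at roots of the characteristic polynomial of [-X], of which
    there are finitely many. *)
Lemma exists_unitmx_shift n (X : 'M[R]_n) (delta : R) : 0 < delta ->
  exists2 e, 0 < e < delta & X + e%:M \in unitmx.
Proof.
move=> d0; set p := char_poly (- X).
have pe e : (X + e%:M \in unitmx) = (p.[e] != 0).
  rewrite unitmxE unitfE /p /char_poly -horner_evalE -det_map_mx.
  congr (\det _ != 0).
  apply/matrixP => i j; rewrite !mxE /= !horner_evalE !hornerE.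
  by rewrite opprK hornerMn hornerX addrC.
apply: contrapT => noe.
have root e : 0 < e < delta -> root p e.
  move=> he; apply: contraT => nr; exfalso; apply: noe; exists e => //.
  by rewrite pe.
(* One more point than the degree of [p]; the offset 2 keeps all of them strictly below [delta]. *)
pose s := [seq delta / k.+2%:R | k <- iota 0 (size p)].
suff: (size s < size p)%N by rewrite size_map size_iota ltnn.
apply: max_poly_roots; first by rewrite monic_neq0 ?char_poly_monic.
  apply/allP => _ /mapP[k _ ->]; apply: root.
  rewrite divr_gt0 ?ltr0n //= ltr_pdivrMr ?ltr0n // ltr_pMr //.
  by rewrite ltr1n.
rewrite map_inj_uniq ?iota_uniq // => k l /(mulfI (lt0r_neq0 d0))/invr_inj/eqP.
by rewrite eqr_nat => /eqP[].
Qed.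

End ContinuousFamilies.

(* Dispatches on the syntax of the goal: trying the lemmas in turn would let
   unification unfold the matrix operations. *)
Ltac mxcts := lazymatch goal with
  | |- mxcts0 (fun _ => ?X) => exact (@mxcts0_cst _ _ _ X)
  | |- mxcts0 (fun e => - @?F e) => apply (@mxcts0N _ _ _ F); mxcts
  | |- mxcts0 (fun e => @?F e + @?G e) => apply (@mxcts0D _ _ _ F G); mxcts
  | |- mxcts0 (fun e => ?a *: @?F e) =>
      apply (@mxcts0Z _ _ _ (fun=> a) F); [exact: cvg_cst | mxcts]
  | |- mxcts0 (fun e => @?F e *m @?G e) => apply (@mxcts0M _ _ _ _ F G); mxcts
  | |- mxcts0 (fun e => trmx (@?F e)) => apply (@mxcts0_tr _ _ _ F); mxcts
  | |- mxcts0 (fun e => row_mx (@?F e) (@?G e)) =>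
      apply (@mxcts0_row _ _ _ _ F G); mxcts
  | |- mxcts0 (fun e => col_mx (@?F e) (@?G e)) =>
      apply (@mxcts0_col _ _ _ _ F G); mxcts
  | |- mxcts0 (fun e => lsubmx (@?F e)) => apply (@mxcts0_lsub _ _ _ _ F); mxcts
  | |- mxcts0 (fun e => rsubmx (@?F e)) => apply (@mxcts0_rsub _ _ _ _ F); mxcts
  | |- mxcts0 (fun e => usubmx (@?F e)) => apply (@mxcts0_usub _ _ _ _ F); mxcts
  | |- mxcts0 (fun e => dsubmx (@?F e)) => apply (@mxcts0_dsub _ _ _ _ F); mxcts
  | |- _ => assumption
  end.

(** * Orthogonality of the block selectors *)

Section Selectors.
Context {R : realType} {d n : nat}.

Lemma selmx_mul_tr k l : (k.+1 * d <= n)%N ->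
  selmx k *m (selmx l : 'M[R]_(d, n))^T = (k == l)%:R%:M.
Proof.
move=> kn; apply/matrixP => i j; rewrite !mxE.
have ltn : (k * d + i < n)%N.
  by apply: leq_trans kn; rewrite mulSn addnC ltn_add2r.
rewrite (bigD1 (Ordinal ltn)) //= !mxE eqxx mul1r big1 ?addr0 => [|m mk].
  (* Quotient and remainder modulo [d] recover the block and the position in it; [d] is positive
     since [i] lies below it. *)
  have eq : (k * d + i == l * d + j)%N = (k == l) && (i == j).
    apply/eqP/andP => [E|[/eqP-> /eqP->]//].
    have d0 : (0 < d)%N by exact: leq_trans (ltn_ord i).
    split.
      have := congr1 (divn^~ d) E.
      by rewrite !divnMDl // !divn_small ?addn0 // => ->.
    apply/eqP/val_inj => /=; have := congr1 (modn^~ d) E.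
    by rewrite !modnMDl !modn_small.
  by rewrite eq; case: (k == l); case: (i == j); rewrite /= ?mulr1n ?mul0rn.
rewrite !mxE; case: eqP => [E|_]; last by rewrite mul0r.
by case/eqP: mk; apply: val_inj.
Qed.

End Selectors.

(** * The Schur complement step and changes of state *)

Section Equivalence.
Context {R : realType} {d n : nat} (M L : 'M[R]_d) (rho : R).
Hypothesis sLM : (L - M)^T = L - M.
Implicit Types (At : 'M[R]_n) (B : 'M[R]_(n, d)) (C : 'M[R]_(d, n)).
Implicit Types (P : 'M[R]_(n + d)) (lam r : R).

Lemma analysis_negdefP At B C P lam r : P^T = P ->
  negdefmx (analysis_mx M L rho At B C P lam r) <->
  forall x y u, (x != 0) || (y != 0) || (u != 0) ->
    dissipation M L rho C P lam r x (At *m x + B *m y) y u < 0.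
Proof.
move=> sP; rewrite negdefmxE; split=> [[_ neg] x y u xyu|neg].
  by rewrite -analysis_form // neg // !col_mx_eq0 !negb_and orbA.
split=> [|v]; first exact: tr_analysis_mx.
rewrite -[v]vsubmxK -[dsubmx v]vsubmxK !col_mx_eq0 !negb_and orbA => /neg.
by rewrite -analysis_form.
Qed.

(** The last two block rows and columns of the synthesis matrix form [-P], so vectors supported
    there are the test vectors. *)
Lemma synthesis_posdef Ah Bh C P r lam : P^T = P ->
  negdefmx (synthesis_mx M L rho Ah Bh C P r lam) -> posdefmx P.
Proof.
move=> sP /negdefmxE[_ neg]; apply/posdefmxE; split=> // w w0.
have := neg (col_mx 0 (col_mx 0 (col_mx 0 w))).
rewrite !col_mx_eq0 (negbTE w0) !andbF => /(_ isT).
rewrite -[w]vsubmxK /synthesis_mx !mul_col_mx !mul_row_col !mulmx0 !add0r.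
rewrite !dot_col !(dotC 0) !dot0r !add0r -dot_col.
rewrite -mul_row_col -mul_row_col -mul_col_mx -!opp_row_mx -opp_col_mx.
by rewrite -/(block_mx _ _ _ _) submxK mulNmx dotNr oppr_lt0.
Qed.

Lemma synthesis_negdefP At B C P r lam :
  P^T = P -> C = J2 *m ulsubmx P -> dlsubmx P = J3 *m ulsubmx P ->
  negdefmx (synthesis_mx M L rho (ulsubmx P *m At) (ulsubmx P *m B) C P r lam) <->
  posdefmx P /\ negdefmx (analysis_mx M L rho At B C P lam r).
Proof.
move=> sP CE P21;
split=> [neg|[/posdefmxE[_ pP] /(analysis_negdefP _ _ _ _ _ sP) neg]].
  split; first exact: synthesis_posdef neg.
  apply/analysis_negdefP => // x y u xyu; have [_ {}neg] := (negdefmxE _).1 neg.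
  (* The choice [(p, q) = (s, u)] makes the subtracted square vanish. *)
  have := neg (col_mx x (col_mx y (col_mx u (col_mx (At *m x + B *m y) u)))).
  rewrite synthesis_form // !subrr !col_mx_eq0 !negb_and !orbA xyu => /(_ isT).
  by rewrite /storage col_mx0 mulmx0 dot0r subr0.
apply/negdefmxE; split=> [|v]; first exact: tr_synthesis_mx.
rewrite -[v]vsubmxK -[dsubmx v]vsubmxK -[dsubmx (dsubmx v)]vsubmxK.
rewrite -[dsubmx (dsubmx (dsubmx v))]vsubmxK.
set x := usubmx v; set y := usubmx _; set u := usubmx _.
set p := usubmx _; set q := dsubmx _; rewrite synthesis_form //.
set s := At *m x + B *m y.
have st0 : 0 <= storage P (p - s) (q - u).
  by apply: posdefmx_ge0; apply/posdefmxE.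
rewrite !col_mx_eq0 !negb_and !orbA.
have [xyu _|] := boolP ((x != 0) || (y != 0) || (u != 0)).
  by have := neg x y u xyu; rewrite -/s; lra.
(* When [x], [y] and [u] vanish, only minus the storage of the nonzero [(p, q)] remains. *)
rewrite !negb_or !negbK => /andP[/andP[/eqP x0 /eqP y0] /eqP u0].
have s0 : s = 0 by rewrite /s x0 y0 !mulmx0 addr0.
rewrite x0 y0 u0 s0 /= !subr0 /dissipation !mulmx0 !dot0r /storage.
rewrite !col_mx0 mulmx0 !dot0r => pq0.
have := pP (col_mx p q); rewrite col_mx_eq0 negb_and => /(_ pq0); lra.
Qed.

Lemma analysis_fixedpoint_free At B C P lam r : 0 <= rho < 1 -> posdefmx P ->
  negdefmx (analysis_mx M L rho At B C P lam r) -> At - 1%:M \in unitmx.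
Proof.
move=> /andP[rho0 rho1] hP /analysis_negdefP neg.
have [sP _] := (posdefmxE _).1 hP; apply: contraT => /singular_ker[x x0]; rewrite mulmxBl mul1mx => /subr0_eq Atx.
(* At a fixed vector of [At] the dissipation is [(1 - rho^2)] times the storage of [(x, 0)], hence
   nonnegative. *)
have := neg sP x 0 0; rewrite x0 => /(_ isT).
rewrite mulmx0 addr0 Atx /dissipation !mulmx0 ![dot 0 _]dotC !dot0r.
have : 0 <= storage P x 0 by exact: posdefmx_ge0.
have : rho ^+ 2 <= 1 by rewrite expr_le1 // ltW.
nra.
Qed.

(** [S] sends [(x, y)] to [(T x, y)], so a change of state leaves all terms in [y] and [u] alone
    untouched. *)
Lemma dissipation_congr C P lam r (T : 'M[R]_n) x s y u :
  let S : 'M[R]_(n + d) := block_mx T 0 0 1%:M in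
  dissipation M L rho (C *m T) (S^T *m P *m S) lam r x s y u =
  dissipation M L rho C P lam r (T *m x) (T *m s) y u.
Proof.
move=> S; have st a b : storage (S^T *m P *m S) a b = storage P (T *m a) b.
  rewrite /storage -!mulmxA dot_tr dotC.
  by rewrite /S mul_block_col !mul0mx mul1mx addr0 add0r.
by rewrite /dissipation !st -!mulmxA.
Qed.

Lemma analysis_congr At B C P lam r (T : 'M[R]_n) : T \in unitmx -> P^T = P ->
  let S : 'M[R]_(n + d) := block_mx T 0 0 1%:M in
  negdefmx (analysis_mx M L rho At B C P lam r) ->
  negdefmx (analysis_mx M L rho (invmx T *m At *m T) (invmx T *m B) (C *m T)
              (S^T *m P *m S) lam r).
Proof.
move=> Tu sP S /(analysis_negdefP _ _ _ _ _ sP) neg.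
apply/analysis_negdefP => [|x y u xyu].
  by rewrite !trmx_mul trmxK sP mulmxA.
rewrite dissipation_congr -!mulmxA -mulmxDr mulKVmx //; apply: neg.
suff -> : (T *m x != 0) = (x != 0) by [].
congr (~~ _); apply/eqP/eqP => [Tx0|->]; last by rewrite mulmx0.
by rewrite -[x](mulKmx Tu) Tx0 mulmx0.
Qed.

End Equivalence.

(** * From the analysis to the synthesis conditions *)

Section Main.
Context {R : realType} {d n : nat} (M L : 'M[R]_d) (rho : R).
Hypotheses (sLM : (L - M)^T = L - M) (hn : (3 * d <= n)%N).
Implicit Types (At T : 'M[R]_n) (B : 'M[R]_(n, d)) (C : 'M[R]_(d, n)).
Implicit Types (P : 'M[R]_(n + d)) (lam r : R).

Local Notation J1 := (@J1 R d n).
Local Notation J2 := (@J2 R d n).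
Local Notation J3 := (@J3 R d n).

(** Bundled as a multi-rule so that one [rewrite] evaluates any product of selectors; [3 * d <= n]
    makes the three blocks fit. *)
Lemma selJ :
  ((J1 *m J1^T = 1%:M) * (J1 *m J2^T = 0) * (J1 *m J3^T = 0) *
   (J2 *m J1^T = 0) * (J2 *m J2^T = 1%:M) * (J2 *m J3^T = 0) *
   (J3 *m J1^T = 0) * (J3 *m J2^T = 0) * (J3 *m J3^T = 1%:M))%type.
Proof.
have JJ k l : (k < 3)%N ->
    selmx k *m (selmx l : 'M[R]_(d, n))^T = if k == l then 1%:M else 0.
  move=> k3; rewrite selmx_mul_tr.
    by case: (k == l); rewrite // -scalemx1 scale0r.
  by rewrite (leq_trans _ hn) // leq_mul2r k3 orbT.
by rewrite /Defs.J1 /Defs.J2 /Defs.J3 !JJ.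
Qed.

(** The hypotheses say that the first three block columns of [T] are [K], [P11^-1 C^T] and
    [P11^-1 P12]; in the state [z] with [x = T z] they become the structural constraints. *)
Lemma analysis_to_synthesis At C P lam r T :
  let K := T *m J1^T in
  let B := (At - 1%:M) *m K *m invmx M in
  let S : 'M[R]_(n + d) := block_mx T 0 0 1%:M in
  M \in unitmx -> T \in unitmx -> posdefmx P -> 0 <= lam <= rho ^+ 2 ->
  negdefmx (analysis_mx M L rho At B C P lam r) ->
  C *m K = 1%:M -> C = J2 *m T^T *m ulsubmx P ->
  ursubmx P = ulsubmx P *m T *m J3^T ->
  synthesis_conditions M L rho (T^T *m ulsubmx P *m At *m T)
    (T^T *m ulsubmx P *m B) (C *m T) (S^T *m P *m S) r lam.
Proof.
move=> K B S Mu Tu hP hlam neg CK CE P12E.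
have [sP _] := (posdefmxE _).1 hP; have [sP11 P12T _ _] := tr_submx sP.
have SPS : S^T *m P *m S = block_mx (T^T *m ulsubmx P *m T) (T^T *m ursubmx P)
    (dlsubmx P *m T) (drsubmx P).
  rewrite -{1}[P]submxK /S tr_block_mx !trmx0 trmx1 !mulmx_block.
  by rewrite !(mul0mx, mulmx0, mul1mx, mulmx1, addr0, add0r).
have sSPS : (S^T *m P *m S)^T = S^T *m P *m S.
  by rewrite !trmx_mul trmxK sP mulmxA.
have hSPS : posdefmx (S^T *m P *m S).
  by apply: posdefmx_congr hP; rewrite block_diag_mx_unit Tu unitmx1.
have CE' : C *m T = J2 *m ulsubmx (S^T *m P *m S).
  by rewrite SPS block_mxKul CE !mulmxA.
have P21E : dlsubmx (S^T *m P *m S) = J3 *m ulsubmx (S^T *m P *m S).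
  rewrite SPS block_mxKul block_mxKdl -P12T P12E !trmx_mul trmxK sP11.
  by rewrite !mulmxA.
have AE : T^T *m ulsubmx P *m At *m T =
    ulsubmx (S^T *m P *m S) *m (invmx T *m At *m T).
  by rewrite SPS block_mxKul !mulmxA mulmxK.
have BE : T^T *m ulsubmx P *m B = ulsubmx (S^T *m P *m S) *m (invmx T *m B).
  by rewrite SPS block_mxKul !mulmxA mulmxK.
split; split=> //; first exact/symmetricmxP.
- rewrite AE BE; apply: (synthesis_negdefP rho sLM _ _ _ _ sSPS CE' P21E).2.
  split; first exact: hSPS.
  exact: (analysis_congr sLM Tu sP neg).
(* [T^T P11 (At - I) T] is [Ah] minus the new upper left block, which is the constraint on [Bh]. *)
- rewrite SPS block_mxKul /B /K !mulmxA [X in X *m T *m _]mulmxBr mulmx1.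
  by rewrite !mulmxBl.
- by rewrite -mulmxA.
Qed.

Lemma mxcts0_analysis At (B : R -> 'M[R]_(n, d)) (C : R -> 'M[R]_(d, n))
    (P : R -> 'M[R]_(n + d)) lam r : mxcts0 B -> mxcts0 C -> mxcts0 P ->
  mxcts0 (fun e => analysis_mx M L rho At (B e) (C e) (P e) lam r).
Proof.
move=> Bc Cc Pc.
have Oc : mxcts0 (fun e => outer_mx At (B e)) by rewrite /outer_mx; mxcts.
have Sc : mxcts0 (fun e => storage_mx rho (P e)).
  by rewrite /storage_mx /ulsubmx /ursubmx /dlsubmx /drsubmx; mxcts.
have Gc : mxcts0 (fun e => multiplier_mx M L (C e) lam r).
  by rewrite /multiplier_mx; mxcts.
by rewrite /analysis_mx; mxcts.
Qed.

(** * Perturbing the prescribed block columns into an invertible change of state *)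

Section Perturbation.
Variables (At : 'M[R]_n) (B K : 'M[R]_(n, d)) (C : 'M[R]_(d, n)).
Variables (P : 'M[R]_(n + d)) (lam r : R).
Hypotheses (Mu : M \in unitmx) (hP : posdefmx P).
Hypothesis neg : negdefmx (analysis_mx M L rho At B C P lam r).
Hypotheses (CK : C *m K = 1%:M) (BE : B = (At - 1%:M) *m K *m invmx M).

Let P11 := ulsubmx P.

(** At 0, the three prescribed block columns followed by zeros; the shift by [e] serves to restore
    invertibility. *)
Let frame (e : R) :=
  K *m J1 + invmx P11 *m C^T *m J2 + invmx P11 *m ursubmx P *m J3 + e *: 1%:M.

(** The product [C K] computed from the shifted columns: the identity at 0, but not necessarily
    elsewhere. *)
Let gain e := J2 *m (frame e)^T *m P11 *m frame e *m J1^T.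

(* Agrees with [invmx (gain e)] near 0, and is visibly continuous there. *)
Let gainV e := (\det (gain e))^-1 *: \adj (gain e).

(* Normalises the first block column of [frame e] so that [C K = 1] persists. *)
Let pframe e := frame e *m (1%:M + J1^T *m (gainV e - 1%:M) *m J1).

(** The moved data are read off [pframe e], so the structural relations other than [C' K' = I] hold
    by construction; [P11] and [P22] stay fixed. *)
Let K' e := pframe e *m J1^T.
Let B' e := (At - 1%:M) *m K' e *m invmx M.
Let C' e := J2 *m (pframe e)^T *m P11.
Let P' e := block_mx P11 (P11 *m pframe e *m J3^T)
                     (P11 *m pframe e *m J3^T)^T (drsubmx P).

(** The correction only changes the first block column, so normalising [K'] does not disturb
    [C']. *)
Lemma pframe_J2 e : pframe e *m J2^T = frame e *m J2^T.
Proof.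
by rewrite /pframe -mulmxA mulmxDl mul1mx -!mulmxA selJ !mulmx0 addr0.
Qed.

Lemma pframe_J1 e : pframe e *m J1^T = frame e *m J1^T *m gainV e.
Proof.
rewrite /pframe -mulmxA mulmxDl mul1mx -!mulmxA selJ mulmx1 -[X in X + _]mulmx1.
by rewrite -mulmxDr addrC subrK.
Qed.

Lemma frame0 : [/\ frame 0 *m J1^T = K, frame 0 *m J2^T = invmx P11 *m C^T
  & frame 0 *m J3^T = invmx P11 *m ursubmx P].
Proof.
rewrite /frame scale0r addr0 !mulmxDl -!mulmxA !selJ.
by rewrite !(mulmx0, mulmx1, addr0, add0r).
Qed.

Lemma trP11 : P11^T = P11.
Proof. by have [sP _] := (posdefmxE _).1 hP; case: (tr_submx sP). Qed.

Lemma P11_unit : P11 \in unitmx.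
Proof. exact/posdefmx_unit/posdefmx_ul. Qed.

Lemma J2_frame0 : J2 *m (frame 0)^T *m P11 = C.
Proof.
have [_ fJ2 _] := frame0; apply: trmx_inj.
by rewrite !trmx_mul !trmxK trP11 fJ2 mulKVmx // P11_unit.
Qed.

Lemma gain0 : gain 0 = 1%:M.
Proof. by have [fJ1 _ _] := frame0; rewrite /gain J2_frame0 -mulmxA fJ1. Qed.

Lemma gainV0 : gainV 0 = 1%:M.
Proof. by rewrite /gainV gain0 det1 invr1 scale1r adj1. Qed.

Lemma pframe0 : pframe 0 = frame 0.
Proof. by rewrite /pframe gainV0 subrr mulmx0 mul0mx addr0 mulmx1. Qed.

Lemma gain_gainV e : \det (gain e) != 0 -> gain e *m gainV e = 1%:M.
Proof.
by move=> g0; rewrite /gainV -scalemxAr mul_mx_adj scale_scalar_mx mulVf.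
Qed.

Lemma C'K' e : \det (gain e) != 0 -> C' e *m K' e = 1%:M.
Proof.
move=> g0; rewrite -(gain_gainV g0) /C' /K' /gain pframe_J1.
have -> : J2 *m (pframe e)^T = J2 *m (frame e)^T.
  by apply: trmx_inj; rewrite !trmx_mul !trmxK pframe_J2.
by rewrite !mulmxA.
Qed.

(** Since [J1 J1^T = I], the factor [I + J1^T (G^-1 - I) J1] has inverse [I + J1^T (G - I) J1],
    where [G] is the gain. *)
Lemma pframe_unit e : frame e \in unitmx -> \det (gain e) != 0 ->
  pframe e \in unitmx.
Proof.
move=> fu g0; rewrite unitmx_mul fu /=.
set X := gainV e - 1%:M; pose Y := gain e - 1%:M.
apply: (proj1 (@mulmx1_unit _ _ _ (1%:M + J1^T *m Y *m J1) _)).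
(* The expansion of [(I + X) (I + Y) = I]. *)
have XY : X + Y + X *m Y = 0.
  have := mulmx1C (gain_gainV g0).
  rewrite -[gainV e](subrK 1%:M) -[gain e](subrK 1%:M) -/X -/Y.
  rewrite mulmxDl !mulmxDr !mul1mx !mulmx1 => E.
  by apply: (addIr 1%:M); rewrite add0r -[RHS]E [X + Y + _]addrC !addrA.
clearbody X Y; rewrite mulmxDl mul1mx mulmxDr mulmx1 -!mulmxA
  [J1 *m (J1^T *m _)]mulmxA selJ mul1mx.
rewrite -addrA -mulmxDr -mulmxDr (mulmxA X) -!mulmxDl addrA [Y + X]addrC XY.
by rewrite mul0mx mulmx0 addr0.
Qed.

Lemma C'0 : C' 0 = C.
Proof. by rewrite /C' pframe0 J2_frame0. Qed.

Lemma B'0 : B' 0 = B.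
Proof. by have [fJ1 _ _] := frame0; rewrite /B' /K' pframe0 fJ1. Qed.

Lemma P'0 : P' 0 = P.
Proof.
have [_ _ fJ3] := frame0; have [sP _] := (posdefmxE _).1 hP.
have [_ P12 _ _] := tr_submx sP.
rewrite /P' pframe0 -mulmxA fJ3 mulKVmx ?P11_unit // P12; exact: submxK.
Qed.

Lemma mxcts0_frame : mxcts0 frame.
Proof.
apply: mxcts0D; first exact: mxcts0_cst.
by apply: mxcts0Z; [exact: cvg_id | exact: mxcts0_cst].
Qed.

Lemma mxcts0_gain : mxcts0 gain.
Proof. by have framec := mxcts0_frame; rewrite /gain; mxcts. Qed.

Lemma mxcts0_pframe : mxcts0 pframe.
Proof.
have framec := mxcts0_frame; have gainVc : mxcts0 gainV.
  apply: mxcts0Z (mxcts0_adj mxcts0_gain).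
  by apply: cvgV (cts0_det mxcts0_gain); rewrite gain0 det1 oner_neq0.
by rewrite /pframe; mxcts.
Qed.

(** The moved data equal the original ones at 0, where the three conditions hold; each is strict,
    hence stable under continuous change. *)
Lemma near_analysis :
  \forall e \near (0 : R), [/\ \det (gain e) != 0, posdefmx (P' e)
    & negdefmx (analysis_mx M L rho At (B' e) (C' e) (P' e) lam r)].
Proof.
have tcts := mxcts0_pframe.
have Pcts : mxcts0 P' by rewrite /P' /block_mx; mxcts.
have Bcts : mxcts0 B' by rewrite /B' /K'; mxcts.
have Ccts : mxcts0 C' by rewrite /C'; mxcts.
have sP e : (P' e)^T = P' e.
  rewrite /P' tr_block_mx trmxK trP11.
  have [sP _] := (posdefmxE _).1 hP.
  by have [_ _ _ ->] := tr_submx sP.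
near=> e; split.
- near: e; have /cvgr_neq0 := cts0_det mxcts0_gain; apply.
  by rewrite gain0 det1 oner_neq0.
- by near: e; apply: near_posdefmx; rewrite ?P'0.
- near: e; apply: near_posdefmx.
  + by apply: mxcts0N; exact: mxcts0_analysis.
  + by move=> e; rewrite trmxN tr_analysis_mx.
  + by rewrite B'0 C'0 P'0.
Unshelve. all: end_near.
Qed.

Lemma perturbed_synthesis : 0 <= lam <= rho ^+ 2 ->
  exists (Ah : 'M[R]_n) (Bh : 'M[R]_(n, d)) (C : 'M[R]_(d, n))
           (P : 'M[R]_(n + d)) (r lam : R),
       synthesis_conditions M L rho Ah Bh C P r lam.
Proof.
move=> hlam; have /nbhs_norm0P[delta /= d0 near_d] := near_analysis.
(* One [e] serves both purposes: it lies within the radius where the strict conditions persist, and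
   it makes the frame invertible. *)
have [e /andP[e0 ed] fu] := exists_unitmx_shift
  (K *m J1 + invmx P11 *m C^T *m J2 + invmx P11 *m ursubmx P *m J3) d0.
have [|g0 hP' neg'] := near_d e; first by rewrite /= gtr0_norm.
have Tu : pframe e \in unitmx by apply: pframe_unit; rewrite // /frame scalemx1.
have ul' : ulsubmx (P' e) = P11 by rewrite block_mxKul.
have := @analysis_to_synthesis At (C' e) (P' e) lam r (pframe e) Mu Tu hP' hlam
  neg'.
rewrite ul' => H; do 6!eexists; apply: H.
- exact: C'K'.
- by [].
- by rewrite block_mxKur.
Qed.

End Perturbation.
End Main.

(** * The equivalence and the recovery of the algorithm parameters *)

Unset Implicit Arguments.

Theorem theorem14 (R : realType) (d n : nat) (M L : 'M[R]_d) (rho : R)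
    (hM : M \is symmetricmx) (hL : L \is symmetricmx)
    (hML : loewner_le M L) (hn : (3 * d <= n)%N) (hrho : 0 <= rho < 1) :
  ((exists (A : 'M[R]_n) (B : 'M[R]_(n, d)) (C : 'M[R]_(d, n)),
       analysis_feasible M L rho A B C) <->
   (exists (Ah : 'M[R]_n) (Bh : 'M[R]_(n, d)) (C : 'M[R]_(d, n))
           (P : 'M[R]_(n + d)) (r lam : R),
       synthesis_conditions M L rho Ah Bh C P r lam)) /\
  (forall (Ah : 'M[R]_n) (Bh : 'M[R]_(n, d)) (C : 'M[R]_(d, n))
          (P : 'M[R]_(n + d)) (r lam : R),
       synthesis_conditions M L rho Ah Bh C P r lam ->
       ulsubmx P \in unitmx /\
       let B := invmx (ulsubmx P) *m Bh in
       let A := invmx (ulsubmx P) *m Ah - B *m M *m C in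
       analysis_feasible M L rho A B C).
Proof.
have sLM : (L - M)^T = L - M.
  by rewrite trmxB (symmetricmxP _ hL) (symmetricmxP _ hM).
(* The parameter recovery comes first, since it also yields the implication from (b) to (a). *)
have moreover (Ah : 'M[R]_n) (Bh : 'M[R]_(n, d)) C P r lam :
    synthesis_conditions M L rho Ah Bh C P r lam ->
    ulsubmx P \in unitmx /\
    let B := invmx (ulsubmx P) *m Bh in
    let A := invmx (ulsubmx P) *m Ah - B *m M *m C in
    analysis_feasible M L rho A B C.
  move=> [[/symmetricmxP sP hlam neg] [Mu BhE CJ CE P21E]].
  have hP := synthesis_posdef sP neg.
  have P11u : ulsubmx P \in unitmx by exact/posdefmx_unit/posdefmx_ul.
  split=> // B A; exists P, lam, r.
  have AtE : A + B *m M *m C = invmx (ulsubmx P) *m Ah by rewrite subrK.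
  have [_ aneg] : posdefmx P /\ negdefmx (analysis_mx M L rho
      (invmx (ulsubmx P) *m Ah) (invmx (ulsubmx P) *m Bh) C P lam r).
    apply: (synthesis_negdefP rho sLM _ _ _ _ sP CE P21E).1.
    by rewrite !mulKVmx.
  have Atu := analysis_fixedpoint_free sLM hrho hP aneg.
  rewrite /analysis_conditions AtE; split=> //.
  (* The constraint on [Bh] makes [B M] a multiple of [At - I]; its inverse then cancels and leaves
     [C J1^T = I]. *)
  have BM : B *m M = (invmx (ulsubmx P) *m Ah - 1%:M) *m J1^T.
    rewrite /B BhE mulmxA mulmxKV // mulmxA mulmxBr.
    by rewrite (mulVmx P11u).
  by rewrite -(mulmxA _ B M) BM -(mulmxA C) mulKmx.
split; last exact: moreover.
split=> [[A [B [C [P [lam [r]]]]]]|[Ah [Bh [C [P [r [lam /moreover[_ h]]]]]]]].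
  rewrite /analysis_conditions; set At := A + _ => -[hP hlam Atu CK neg].
  (* The square matrix [M] has a left inverse by the identity in (a), so it is invertible. *)
  have [_ Mu] := mulmx1_unit CK.
  (* With this [K] the identity in (a) reads [C K = I], and [B] is recovered as
     [(At - I) K M^-1]. *)
  pose K := invmx (At - 1%:M) *m B *m M.
  apply: (@perturbed_synthesis _ _ _ _ _ rho sLM hn _ _ K _ _ _ _ Mu hP neg)
    => //.
    by rewrite /K -[RHS]CK !mulmxA.
  by rewrite /K !mulmxA mulmxV // mul1mx mulmxK.
by do 3!eexists; exact: h.
Qed.
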